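(* Let $G=(V,E)$ be a finite graph of maximum degree $\Delta$, and let $\beta,\gamma>0$. Suppose that for each subset $B\subseteq V$ there is a probability distribution over the collection $\mathcal{I}(G[B])$ of independent sets of $G[B]$ such that, writing $X_B$ for a random independent set with this distribution, for all $u\in B$, $$\beta\Pr(u\in X_B)+\gamma\,\mathbb{E}|X_B\cap N_{G[B]}(u)|\ge 1.$$ Then $$\chi_f(G)\le\beta+\gamma\Delta.$$
   Context: $G[B]$ is the subgraph of $G$ induced by $B$, and $N_{G[B]}(u)$ is the set of neighbours of $u$ in $G[B]$. $\mathcal{I}(G)$ is the collection of independent sets of $G$, including $\varnothing$. For real $k>0$, a fractional $k$-colouring of $G$ is a probability distribution over $\mathcal{I}(G)$ such that, if $X_f$ denotes the random independent set, $\Pr(u\in X_f)\ge 1/k$ for each $u\in V$. The fractional chromatic number $\chi_f(G)$ is the least $k$ for which $G$ admits a fractional $k$-colouring. *)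

(* Defs.v *)
From HB Require Import structures.
From mathcomp Require Import all_boot all_order all_algebra.
From mathcomp Require Import boolp classical_sets reals.
From mathcomp Require Import topology normedtype derive.

Set Implicit Arguments.
Unset Strict Implicit.
Unset Printing Implicit Defensive.

Import Order.TTheory GRing.Theory Num.Theory.

Local Open Scope ring_scope.

Record sgraph := SGraph {
  vertex :> finType;
  adj : rel vertex;
  adj_sym : symmetric adj;
  adj_irr : irreflexive adj
}.

Section Graph.
Variable G : sgraph.

Definition nbhd (u : G) : {set G} := [set v | adj u v].

Definition max_degree : nat := \max_(u : G) #|nbhd u|.

Definition independent (S : {set G}) : bool :=
  [forall u in S, forall v in S, ~~ adj u v].

Definition indep_set : finType := {S : {set G} | independent S}.

Section Induced.
Variable B : {set G}.

Definition induced_adj : rel {u : G | u \in B} :=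
  [rel u v | adj (val u) (val v)].

Lemma induced_adj_sym : symmetric induced_adj.
Proof. by move=> u v; exact: adj_sym. Qed.

Lemma induced_adj_irr : irreflexive induced_adj.
Proof. by move=> u; exact: adj_irr. Qed.

Definition induced : sgraph := SGraph induced_adj_sym induced_adj_irr.

End Induced.
End Graph.

Record fdist (R : realType) (T : finType) := FDist {
  pmf :> T -> R;
  pmf_ge0 : forall x, 0 <= pmf x;
  pmf_sum1 : \sum_x pmf x = 1
}.

Definition Pr (R : realType) (T : finType) (mu : fdist R T) (P : pred T) : R :=
  \sum_(x | P x) mu x.

Definition Ex (R : realType) (T : finType) (mu : fdist R T) (f : T -> R) : R :=
  \sum_x mu x * f x.

Definition fractional_colouring (R : realType) (G : sgraph) (k : R)
    (mu : fdist R (indep_set G)) : Prop :=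
  forall u : G, 1 / k <= Pr mu (fun X => u \in val X).

(* For a nonempty graph this infimum is attained (chi_f_attained below), so it
   is the least k. For the empty graph every k > 0 is admissible and there is no
   least one; the infimum is then 0. *)
Definition chi_f (R : realType) (G : sgraph) : R :=
  inf [set k : R | 0 < k /\
    exists mu : fdist R (indep_set G), fractional_colouring k mu]%classic.

Import numFieldNormedType.Exports.
Local Open Scope classical_set_scope.
Local Open Scope ring_scope.

Lemma chi_f_attained (R : realType) (G : sgraph) : (0 < #|G|)%N ->
  0 < chi_f R G /\
  exists mu : fdist R (indep_set G), fractional_colouring (chi_f R G) mu.
Proof.
move=> G0.
have ind1 (u : G) : independent [set u]%SET.
  apply/forall_inP => x /set1P ->; apply/forall_inP => y /set1P ->.
  by rewrite adj_irr.
pose s1 (u : G) : indep_set G := exist _ [set u]%SET (ind1 u).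
pose n := #|indep_set G|.
pose M : R := #|G|%:R.
have M0 : 0 < M by rewrite ltr0n.
have M1 : 1 <= M by rewrite ler1n.
pose p (v : 'rV[R]_(n.+1)) (X : indep_set G) := v ord0 (lift ord0 (enum_rank X)).
have pc X : continuous (fun v : 'rV[R]_(n.+1) => p v X) by exact: coord_continuous.
pose pr (u : G) v := \sum_(X : indep_set G | u \in val X) p v X.
have sumc (P : pred (indep_set G)) :
    continuous (fun v : 'rV[R]_(n.+1) => \sum_(X | P X) p v X).
  move=> v; apply: (@cvg_big _ _ _ _ _ _ _ (nbhs v)).
  - exact: add_continuous.
  - by move=> X _; exact: pc.
pose A := [set v : 'rV[R]_(n.+1) | [/\ forall i, 0 <= v ord0 i <= M,
  \sum_X p v X = 1 & forall u, 1 <= v ord0 ord0 * pr u v]].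
pose pk (k : R) (mu : fdist R (indep_set G)) : 'rV[R]_n.+1 :=
  \row_i oapp (fun j => mu (enum_val j)) k (unlift ord0 i).
have pkE k mu X : p (pk k mu) X = mu X by rewrite /p mxE liftK /= enum_rankK.
have pk0 k mu : pk k mu ord0 ord0 = k by rewrite mxE unlift_none.
have pkA k mu : 0 < k -> k <= M -> fractional_colouring k mu -> A (pk k mu).
  move=> k0 kM fc; split.
  - move=> i; rewrite mxE; case: unliftP => [j _|_] /=; last by rewrite ltW.
    rewrite pmf_ge0 /= (le_trans _ M1) // -(pmf_sum1 mu).
    rewrite (bigD1 (enum_val j)) //= lerDl sumr_ge0 // => X _; exact: pmf_ge0.
  - by under eq_bigr do rewrite pkE; exact: pmf_sum1.
  - move=> u; rewrite pk0 /pr; under eq_bigr do rewrite pkE.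
    by have := fc u; rewrite ler_pdivrMr // mulrC.
have exM : exists mu : fdist R (indep_set G), fractional_colouring M mu.
  pose f X : R := \sum_(u : G) (X == s1 u)%:R / M.
  have f0 X : 0 <= f X by apply: sumr_ge0 => u _; rewrite divr_ge0 // ltW.
  have f1 : \sum_X f X = 1.
    rewrite exchange_big /= (eq_bigr (fun=> M^-1)) => [|u _].
      by rewrite sumr_const -[_ *+ _]mulr_natr mulVf // gt_eqF.
    rewrite (bigD1 (s1 u)) //= eqxx big1 => [|X /negPf ->]; last by rewrite mul0r.
    by rewrite addr0 mul1r.
  exists (FDist f0 f1) => u; rewrite /Pr /=.
  rewrite (bigD1 (s1 u)) /=; last by rewrite inE.
  apply: (@le_trans _ _ (f (s1 u))); last by rewrite lerDl sumr_ge0.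
  by rewrite /f (bigD1 u) //= eqxx lerDl sumr_ge0 // => v _; rewrite divr_ge0 // ltW.
have A0 : A !=set0 by have [mu fc] := exM; exists (pk M mu); exact: pkA.
have cA : compact A.
  apply: (@subclosed_compact _ _ [set v : 'rV[R]_n.+1 | forall i, `[0, M]%classic (v ord0 i)]); last 2 first.
  - by apply: (@rV_compact R n.+1 (fun=> `[0, M]%classic)) => i; exact: segment_compact.
  - by move=> v [vM _ _] i /=; rewrite in_itv /=; exact: vM.
  have -> : A = \bigcap_i [set v : 'rV[R]_n.+1 | 0 <= v ord0 i]
     `&` \bigcap_i [set v : 'rV[R]_n.+1 | v ord0 i <= M]
     `&` [set v | \sum_X p v X = 1]
     `&` \bigcap_u [set v : 'rV[R]_n.+1 | 1 <= v ord0 ord0 * pr u v].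
    apply/seteqP; split => v.
      move=> [h1 h2 h3]; split; last by move=> u _; exact: h3.
      by split => //; split => i _ /=; have /andP[] := h1 i.
    move=> [[[h1 h1'] h2] h3]; split => // [i|u]; last exact: h3.
    by rewrite [X in X && _]h1 //= h1'.
  have cc i : continuous (fun v : 'rV[R]_n.+1 => v ord0 i) by exact: coord_continuous.
  have cge (f : 'rV[R]_n.+1 -> R) (a : R) :
      continuous f -> closed [set v | a <= f v].
    move=> /continuous_closedP/(_ [set x | a <= x]); apply; exact: closed_ge.
  have cle (f : 'rV[R]_n.+1 -> R) (a : R) :
      continuous f -> closed [set v | f v <= a].
    move=> /continuous_closedP/(_ [set x | x <= a]); apply; exact: closed_le.
  have ceq (f : 'rV[R]_n.+1 -> R) (a : R) :
      continuous f -> closed [set v | f v = a].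
    move=> /continuous_closedP/(_ [set x | x = a]); apply; exact: closed_eq.
  apply: closedI; first apply: closedI; first apply: closedI.
  - by apply: closed_bigI => i _; apply: cge; exact: cc.
  - by apply: closed_bigI => i _; apply: cle; exact: cc.
  - by apply: ceq; exact: (sumc predT).
  - apply: closed_bigI => u _; apply: cge => v.
    apply: continuousM; [exact: cc|exact: sumc].
have [c /set_mem [cM c1 cu] cmin] := EVT_min_rV A0 cA
  (continuous_subspaceT (@coord_continuous R 1 n.+1 ord0 ord0)).
set k0 := c ord0 ord0 in cmin cu.
have /card_gt0P [u0 _] := G0.
have k00 : 0 < k0.
  rewrite lt_neqAle; have /andP[-> _] := cM ord0; rewrite andbT.
  by apply/eqP => k0E; have := cu u0; rewrite -k0E mul0r ler10.
have p0 X : 0 <= p c X by have /andP[] := cM (lift ord0 (enum_rank X)).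
have fc0 : fractional_colouring k0 (FDist p0 c1).
  by move=> u; rewrite ler_pdivrMr // mulrC; exact: cu.
suff -> : chi_f R G = k0 by split => //; exists (FDist p0 c1).
have lb : lbound [set k : R | 0 < k /\
    exists mu : fdist R (indep_set G), fractional_colouring k mu] k0.
  move=> k [k_gt0 [mu fc]]; case: (leP k M) => [kM|/ltW Mk].
    by have := cmin _ (mem_set (pkA k mu k_gt0 kM fc)); rewrite pk0.
  by apply: le_trans Mk; have /andP[] := cM ord0.
apply/eqP; rewrite eq_le; apply/andP; split.
  by apply: ge_inf; [exists k0|split => //; exists (FDist p0 c1)].
by apply: lb_le_inf => //; exists k0; split => //; exists (FDist p0 c1).
Qed.

(* Main.v *)
Require Import Defs.
From mathcomp Require Import all_boot all_order all_algebra.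
From mathcomp Require Import boolp classical_sets reals.

Set Implicit Arguments.
Unset Strict Implicit.
Unset Printing Implicit Defensive.

Import Order.TTheory GRing.Theory Num.Theory.

Local Open Scope ring_scope.

(** Greedy fractional colouring. Give the independent sets of [G] weights, all
    initially zero, and let [B] be the set of vertices that are not yet covered
    with total weight 1. While [B] is nonempty, increase the weights in
    proportion to the distribution of [X_B] until some vertex of [B] reaches
    coverage exactly 1, and delete that vertex from [B]. As long as [u] is in
    [B], the hypothesis makes [beta * c(u) + gamma * sum_(v ~ u) c(v)] grow at
    least as fast as the total weight, where [c] denotes the coverage. Coverages
    never exceed 1, so for the last vertex to be deleted this quantity, hence
    the total weight, is at most [beta + gamma * Delta]. *)

(** The weights need not sum to 1, since the greedy process lets the total grow; for a distribution
    this is the probability that [u] lies in the random set. *)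
Definition coverage (R : realType) (G : sgraph) (w : indep_set G -> R) (u : G)
  : R := \sum_(X : indep_set G | u \in val X) w X.

Lemma coverage_le_sum (R : realType) (G : sgraph) (w : indep_set G -> R) u :
  (forall X, 0 <= w X) -> coverage w u <= \sum_X w X.
Proof.
move=> w0; rewrite (bigID (fun X : indep_set G => u \in val X)) /=.
by rewrite lerDl sumr_ge0.
Qed.

Lemma coverageDZ (R : realType) (G : sgraph) (w q : indep_set G -> R) t u :
  coverage (fun X => w X + t * q X) u = coverage w u + t * coverage q u.
Proof. by rewrite /coverage big_split /= mulr_sumr. Qed.

Lemma independent_imset_val (G : sgraph) (B : {set G}) (S : {set induced B}) :
  independent S -> independent ([set val x | x in S] : {set G}).
Proof.
move=> /forall_inP iS; apply/forall_inP => _ /imsetP[x xS ->].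
apply/forall_inP => _ /imsetP[y yS ->].
by have /forall_inP/(_ y yS) := iS x xS.
Qed.

Definition extend_indep (G : sgraph) (B : {set G}) (X : indep_set (induced B))
  : indep_set G := exist (@independent G) _ (independent_imset_val (valP X)).

Lemma coverage_pushforward (R : realType) (T : finType) (G : sgraph)
    (f : T -> indep_set G) (mu : T -> R) (u : G) :
  coverage (fun Y => \sum_(X | f X == Y) mu X) u =
  \sum_(X | u \in val (f X)) mu X.
Proof.
rewrite (partition_big f (fun Y : indep_set G => u \in val Y)) //=.
apply: eq_bigr => Y uY; apply: eq_bigl => X.
by case: eqP => [->|]; rewrite ?uY ?andbF.
Qed.

Lemma Ex_card_setI (R : realType) (G : sgraph) (mu : fdist R (indep_set G))
    (A : {set G}) :
  Ex mu (fun X => #|val X :&: A|%:R) =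
  \sum_(v in A) Pr mu (fun X => v \in val X).
Proof.
rewrite /Ex /Pr [RHS](exchange_big_dep predT) //=.
apply: eq_bigr => X _; rewrite sumr_const mulr_natr.
by congr (_ *+ _); apply: eq_card => v; rewrite !inE andbC.
Qed.

(** Moves the hypothesis from each [G[B]] to [G], so that the distributions for different [B] live
    on one type and can be added up. *)
Lemma pushforward_induced (R : realType) (G : sgraph) (B : {set G})
    (beta gamma : R) (mu : fdist R (indep_set (induced B)))
    (hmu : forall u : induced B, 1 <= beta * Pr mu (fun X => u \in val X)
            + gamma * Ex mu (fun X => #|val X :&: nbhd u|%:R)) :
  exists nu : fdist R (indep_set G),
    (forall u, u \notin B -> coverage nu u = 0) /\
    (forall u, u \in B ->
       1 <= beta * coverage nu u + gamma * \sum_(v in nbhd u) coverage nu v).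
Proof.
pose q Y : R := \sum_(X | @extend_indep G B X == Y) mu X.
have q0 Y : 0 <= q Y by apply: sumr_ge0 => X _; exact: pmf_ge0.
have q1 : \sum_Y q Y = 1.
  by rewrite -(pmf_sum1 mu) [RHS](partition_big (@extend_indep G B) predT).
have cov_val (x : induced B) : coverage q (val x) = Pr mu (fun X => x \in val X).
  rewrite coverage_pushforward; apply: eq_bigl => X /=.
  by rewrite mem_imset //; exact: val_inj.
have cov_out u : u \notin B -> coverage q u = 0.
  move=> uB; rewrite coverage_pushforward big_pred0 // => X.
  by apply/negP => /imsetP[x _ ux]; move: uB; rewrite ux (valP x).
exists (FDist q0 q1); split => //= u uB.
(* Neighbours outside [B] have coverage 0, so only those in [G[B]] contribute. *)
have -> : \sum_(v in nbhd u) coverage q v =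
    \sum_(y in nbhd (exist _ u uB : induced B)) coverage q (val y).
  rewrite (bigID (mem B)) /= [X in _ + X]big1 ?addr0; last first.
    by move=> v /andP[_ /cov_out].
  rewrite (reindex_omap (val : induced B -> G) insub) /=; last first.
    by move=> v /andP[_ vB]; rewrite insubT.
  by apply: eq_bigl => y; rewrite !inE valK eqxx andbT (valP y) andbT.
under eq_bigr do rewrite cov_val.
by rewrite (cov_val (exist _ u uB)) -Ex_card_setI.
Qed.

Section Greedy.
Variables (R : realType) (G : sgraph) (beta gamma : R).
Hypotheses (beta_gt0 : 0 < beta) (gamma_gt0 : 0 < gamma).
Hypothesis hB : forall B : {set G}, exists nu : fdist R (indep_set G),
    (forall u, u \notin B -> coverage nu u = 0) /\
    (forall u, u \in B ->
       1 <= beta * coverage nu u + gamma * \sum_(v in nbhd u) coverage nu v).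

Let bound : R := beta + gamma * (max_degree G)%:R.

Lemma bound_gt0 : 0 < bound.
Proof. by rewrite ltr_wpDr // mulr_ge0 // ltW. Qed.

Lemma local_le_bound (c : G -> R) u : (forall v, c v <= 1) ->
  beta * c u + gamma * \sum_(v in nbhd u) c v <= bound.
Proof.
move=> c1; rewrite lerD //.
  by rewrite -[leRHS]mulr1 ler_wpM2l // ltW.
rewrite (ler_wpM2l (ltW gamma_gt0)) //.
apply: (@le_trans _ _ (\sum_(v in nbhd u) 1)); first by apply: ler_sum.
rewrite sumr_const ler_nat.
exact: (@leq_bigmax _ (fun x : G => #|nbhd x|)).
Qed.

(** Induction on the number of vertices not yet covered. The bound on the total weight is a separate
    invariant because the one over [u \in B] becomes vacuous once [B] is empty. *)
Lemma greedy (n : nat) (B : {set G}) (w : indep_set G -> R) : #|B| = n ->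
  (forall X, 0 <= w X) ->
  (forall u, coverage w u <= 1) ->
  (forall u, u \notin B -> coverage w u = 1) ->
  (forall u, u \in B -> \sum_X w X <=
     beta * coverage w u + gamma * \sum_(v in nbhd u) coverage w v) ->
  \sum_X w X <= bound ->
  exists w' : indep_set G -> R,
    [/\ forall X, 0 <= w' X, forall u, coverage w' u = 1
      & \sum_X w' X <= bound].
Proof.
elim: n B w => [|n IHn] B w cardB w0 cov_le1 cov_out cov_in wbound.
  exists w; split => // u; apply: cov_out.
  by rewrite (cards0_eq cardB) inE.
have [nu [nu_out nu_in]] := hB B.
have nu0 u : 0 <= coverage nu u by apply: sumr_ge0 => X _; exact: pmf_ge0.
have nu_B u : coverage nu u != 0 -> u \in B by apply: contraNT => /nu_out ->.
have [u1 u1B] : exists u, u \in B by apply/card_gt0P; rewrite cardB.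
(* If [nu] covered nothing, [nu_in] at [u1] would read [1 <= 0]. *)
have [u2 u2P] : exists u, coverage nu u != 0.
  apply/existsP; apply: contraT => /existsPn nu00.
  have nuE u : coverage nu u = 0 by apply/eqP; have := nu00 u; rewrite negbK.
  have := nu_in _ u1B; rewrite nuE big1 => [|v _]; last exact: nuE.
  by rewrite !mulr0 addr0 ler10.
(* [F u] is the multiple of [nu] that brings [u] to coverage exactly 1. Where [nu] has coverage 0
   the quotient is a meaningless 0, so the minimum avoids such [u]. *)
pose F u := (1 - coverage w u) / coverage nu u.
have [u0 u0P u0min] :=
  @arg_minP _ _ _ _ (fun u => coverage nu u != 0) F u2P.
set t := F u0 in u0min.
have t0 : 0 <= t by rewrite divr_ge0 // subr_ge0.
pose w' X := w X + t * nu X.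
have w'E u : coverage w' u = coverage w u + t * coverage nu u.
  exact: coverageDZ.
have sumw' : \sum_X w' X = \sum_X w X + t.
  by rewrite big_split /= -mulr_sumr pmf_sum1 mulr1.
have cov_le1' u : coverage w' u <= 1.
  rewrite w'E -lerBrDl; have [->|nu_u] := eqVneq (coverage nu u) 0.
    by rewrite mulr0 subr_ge0.
  by rewrite -ler_pdivlMr ?lt0r ?nu_u ?nu0 //; exact: u0min.
(* The left side grows by [t], as [nu] has mass 1; the right side grows by [t] times a quantity that
   [nu_in] makes at least 1. *)
have cov_in' u : u \in B -> \sum_X w' X <=
    beta * coverage w' u + gamma * \sum_(v in nbhd u) coverage w' v.
  move=> uB; rewrite (eq_bigr _ (fun v _ => w'E v)).
  rewrite sumw' w'E big_split /= -mulr_sumr !mulrDr addrACA lerD ?cov_in //.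
  by rewrite !(mulrCA _ t) -mulrDr -[leLHS]mulr1 ler_wpM2l ?nu_in.
apply: (IHn (B :\ u0) w') => //.
- by move: cardB; rewrite (cardsD1 u0) nu_B // => -[].
- by move=> X; rewrite addr_ge0 // mulr_ge0 // pmf_ge0.
- move=> u; rewrite !inE negb_and negbK => /orP[/eqP ->|uB].
    by rewrite w'E divfK // addrC subrK.
  by rewrite w'E nu_out // mulr0 addr0 cov_out.
- by move=> u /setD1P[_]; exact: cov_in'.
(* [u1] comes from the old [B], so this works even when [u1] is the last vertex and has just been
   deleted. *)
- by apply: (le_trans (cov_in' _ u1B)); exact: local_le_bound.
Qed.

Lemma chi_f_le_bound : chi_f R G <= bound.
Proof.
have cov0 (u : G) : coverage (fun=> 0) u = 0 :> R by rewrite /coverage big1.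
have [|||||w [w0 cov1 wbound]] := @greedy #|[set: G]| [set: G] (fun=> 0) erefl.
- by [].
- by move=> u; rewrite cov0.
- by move=> u; rewrite inE.
- move=> u _; rewrite cov0 big1 // big1 => [|v _]; last exact: cov0.
  by rewrite !mulr0 addr0.
- by rewrite big1 // ltW // bound_gt0.
have sum_ge1 (u : G) : 1 <= \sum_X w X by rewrite -(cov1 u) coverage_le_sum.
apply: ge_inf; first by exists 0 => k [/ltW].
split; first exact: bound_gt0.
(* Total weight 0 forces [G] to have no vertices; any distribution then serves, and [hB] supplies
   one. *)
have [sum0|sum_neq0] := eqVneq (\sum_X w X) 0.
  have [nu _] := hB finset.set0; exists nu => u.
  by have := sum_ge1 u; rewrite sum0 ler10.
have sum_gt0 : 0 < \sum_X w X by rewrite lt0r sum_neq0 sumr_ge0.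
pose p X := w X / \sum_X w X.
have p0 X : 0 <= p X by rewrite divr_ge0 // ltW.
have p1 : \sum_X p X = 1 by rewrite -mulr_suml divff.
(* After normalisation each vertex has probability 1 over the total weight, which is at least
   [1 / bound]. *)
exists (FDist p0 p1) => u.
rewrite /Pr /= -mulr_suml -/(coverage w u) cov1 !div1r.
by rewrite lef_pV2 // posrE bound_gt0.
Qed.

End Greedy.

Theorem theorem3p4 (R : realType) (G : sgraph) (Delta : nat) (beta gamma : R)
  (hDelta : max_degree G = Delta) (hbeta : 0 < beta) (hgamma : 0 < gamma)
  (hB : forall B : {set G}, exists mu : fdist R (indep_set (induced B)),
     forall u : induced B,
       1 <= beta * Pr mu (fun X => u \in val X)
            + gamma * Ex mu (fun X => #|val X :&: nbhd u|%:R)) :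
  chi_f R G <= beta + gamma * Delta%:R.
Proof.
rewrite -hDelta; apply: chi_f_le_bound => // B.
by have [mu hmu] := hB B; exact: pushforward_induced hmu.
Qed.
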